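(* There exist cyclic Beckett-Gray codes for $n = 7$ and for $n = 8$.
   Context: A cyclic $n$-bit binary Gray code is a listing $(w_i)_{i\in\mathbb{Z}/2^n\mathbb{Z}}$ of all words in $\{0,1\}^n$, each occurring exactly once, such that $w_i$ and $w_{i+1}$ differ in exactly one bit position for every $i \in \mathbb{Z}/2^n\mathbb{Z}$ (indices modulo $2^n$). A cyclic Beckett-Gray code (for $n$) is a cyclic $n$-bit binary Gray code in which a $1$ in bit position $p$ is only permitted to change to a $0$ if, among all positions currently containing a $1$, position $p$ has contained its $1$ the longest. Precisely: for a word $w_i$ and a position $q$ at which $w_i$ has a $1$, let the current run length $r_i(q)$ be the largest $m\ge 1$ such that $w_i, w_{i-1}, \ldots, w_{i-m+1}$ all have a $1$ in position $q$ (this is finite and less than $2^n$ because the all-zero word occurs in the cyclic list). The condition is that whenever $w_i$ has a $1$ and $w_{i+1}$ has a $0$ in position $p$, then $r_i(p) > r_i(q)$ for every position $q \neq p$ at which $w_i$ has a $1$. Equivalently, starting the list at the all-zero word with an empty queue, the successive words (returning at the end to the all-zero word) are realized as the successive states of a first-in-first-out queue whose entries are the bit positions currently equal to $1$, each step being a single enqueue or a single dequeue. *)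

(* Defs.v *)
From mathcomp Require Import all_boot.

Set Implicit Arguments.
Unset Strict Implicit.
Unset Printing Implicit Defensive.

(* The cyclic index set Z/2^n is 'I_(2 ^ n), with the cyclic successor [ordS]
   and predecessor [ord_pred]; unlike 'Z_(2 ^ n) this is also right for n = 0. *)
Definition cyclic_Gray_code (n : nat) (w : 'I_(2 ^ n) -> n.-tuple bool) : Prop :=
  bijective w /\
  forall i : 'I_(2 ^ n),
    #|[set p : 'I_n | tnth (w i) p != tnth (w (ordS i)) p]| = 1.

(* w_i, w_{i-1}, ..., w_{i-m+1} all have a 1 in position q. *)
Definition ones_back (n : nat) (w : 'I_(2 ^ n) -> n.-tuple bool)
    (i : 'I_(2 ^ n)) (q : 'I_n) (m : nat) : bool :=
  [forall k : 'I_m, tnth (w (iter k (@ord_pred (2 ^ n)) i)) q].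

(* Bounding m by 2 ^ n loses nothing in a cyclic Gray code, since the all-zero
   word interrupts every run: see [run_lengthP]. *)
Definition run_length (n : nat) (w : 'I_(2 ^ n) -> n.-tuple bool)
    (i : 'I_(2 ^ n)) (q : 'I_n) : nat :=
  \max_(m < 2 ^ n | ones_back w i q m) m.

Definition cyclic_Beckett_Gray_code (n : nat)
    (w : 'I_(2 ^ n) -> n.-tuple bool) : Prop :=
  cyclic_Gray_code w /\
  forall (i : 'I_(2 ^ n)) (p : 'I_n),
    tnth (w i) p -> ~~ tnth (w (ordS i)) p ->
    forall q : 'I_n, q != p -> tnth (w i) q ->
      run_length w i q < run_length w i p.

Lemma val_iter_ord_pred (N : nat) (i : 'I_N) (k : nat) :
  k <= i -> iter k (@ord_pred N) i = i - k :> nat.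
Proof.
elim: k => [|k IHk] lt_ki; first by rewrite subn0.
rewrite iterS /= (IHk (ltnW lt_ki)).
have lt_k : 0 < i - k by rewrite subn_gt0.
have ltN : (i - k).-1 < N.
  by apply: leq_ltn_trans (ltn_ord i); rewrite -subnS leq_subr.
by rewrite subnS -{1}(prednK lt_k) addSn /= modnDr modn_small.
Qed.

Lemma iter_ord_pred_onto (N : nat) (i j : 'I_N) :
  exists2 k, k < N & iter k (@ord_pred N) i = j.
Proof.
case: (leqP j i) => [le_ji | lt_ij].
  exists (i - j); first exact: leq_ltn_trans (leq_subr _ _) (ltn_ord i).
  by apply: val_inj; rewrite /= val_iter_ord_pred ?leq_subr // subKn.
have N_gt0 : 0 < N by apply: leq_ltn_trans (ltn_ord i).
have top : iter i.+1 (@ord_pred N) i = N.-1 :> nat.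
  by rewrite iterS /= val_iter_ord_pred // subnn modn_small // prednK.
have le_jN : j <= N.-1 by rewrite -ltnS prednK.
exists (N.-1 - j + i.+1).
  apply: (@leq_trans (N.-1 - j + j).+1); last by rewrite subnK // prednK.
  by rewrite ltnS leq_add2l.
apply: val_inj; rewrite /= iterD val_iter_ord_pred top ?leq_subr //.
by rewrite subKn.
Qed.

Lemma run_lengthP (n : nat) (w : 'I_(2 ^ n) -> n.-tuple bool)
    (i : 'I_(2 ^ n)) (q : 'I_n) :
  bijective w -> tnth (w i) q ->
  [/\ 0 < run_length w i q, ones_back w i q (run_length w i q)
    & forall m, ones_back w i q m -> m <= run_length w i q].
Proof.
case=> v _ wK wiq.
have lt2n m : ones_back w i q m -> m < 2 ^ n.
  move=> /forallP run_m; have [k ltk wk0] :=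
    iter_ord_pred_onto i (v [tuple of nseq n false]).
  rewrite ltnNge; apply/negP => le_m; have ltkm := leq_trans ltk le_m.
  have := run_m (Ordinal ltkm).
  by rewrite /= wk0 wK (tnth_nth false) /= nth_nseq if_same.
have maxr m : ones_back w i q m -> m <= run_length w i q.
  move=> run_m.
  exact: (@leq_bigmax_cond _ _ (fun k : 'I__ => k : nat) (Ordinal (lt2n m run_m))).
split=> //; first by apply: maxr; apply/forallP => -[[|k]].
rewrite /run_length; elim/big_ind: _ => //; first by apply/forallP => -[].
by move=> a b Ha Hb; rewrite /maxn; case: ifP.
Qed.

(* Main.v *)
Require Import Defs.
From mathcomp Require Import all_boot.

(** A listing that starts at the zero word is determined by the sequence [s] of
    the positions it flips: position [q] holds a 1 at time [i] iff it occurs an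
    odd number of times among the first [i] flips.  If it does, its current run
    started at its last flip, so the FIFO condition says that among the positions
    holding a 1 the dequeued one has the earliest last flip.  All of this is
    decidable from [s]; the two witnesses come from a randomized local search
    that repeatedly replaces a window of a closed queue history by a longer one
    with the same initial and final queue. *)

Definition bit (s : seq nat) (i q : nat) : bool := odd (count_mem q (take i s)).

(** With the history reversed, [index q t] counts the flips made after the last flip of [q], so the
    oldest 1 has the largest index. *)
Definition oldest (n : nat) (s : seq nat) (i p : nat) : bool :=
  let t := rev (take i s) in
  all (fun q => (q != p) && bit s i q ==> (index q t < index p t)) (iota 0 n).

(** Even flip counts bring the word back to zero after [2 ^ n] flips, which closes the cycle. *)
Definition Beckett_flips (n : nat) (s : seq nat) : bool :=
  [&& size s == 2 ^ n, all (ltn^~ n) s,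
      all (fun q => ~~ odd (count_mem q s)) (iota 0 n),
      uniq [seq [seq bit s i q | q <- iota 0 n] | i <- iota 0 (2 ^ n)]
    & all (fun i => bit s i (nth 0 s i) ==> oldest n s i (nth 0 s i))
          (iota 0 (2 ^ n))].

Definition words (n : nat) (s : seq nat) (i : 'I_(2 ^ n)) : n.-tuple bool :=
  [tuple bit s i q | q < n].

Lemma bit0 (s : seq nat) (q : nat) : bit s 0 q = false.
Proof. by rewrite /bit take0. Qed.

Lemma bitS (s : seq nat) (i q : nat) :
  i < size s -> bit s i.+1 q = bit s i q (+) (nth 0 s i == q).
Proof.
move=> lt_is; rewrite /bit (take_nth 0) // -cats1 count_cat oddD /= addn0.
by case: (_ == q).
Qed.

Lemma rev_takeS (s : seq nat) (i : nat) :
  i < size s -> rev (take i.+1 s) = nth 0 s i :: rev (take i s).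
Proof. by move=> lt_is; rewrite (take_nth 0) // rev_rcons. Qed.

(** Induction on time: if the latest flip hits [q], then [q] held a 0 just before and the run has
    length 1; any other flip lengthens both the run and the index by one. The guard [k <= i] stops
    at time 0, so that the claim can be compared with cyclic runs, which may wrap around. *)
Lemma bit_runE (s : seq nat) (i q m : nat) :
  i <= size s -> bit s i q ->
  (forall k, k < m -> k <= i -> bit s (i - k) q) <->
  m <= (index q (rev (take i s))).+1.
Proof.
elim: i m => [|i IHi] m; first by rewrite bit0.
move=> lt_is; rewrite bitS // rev_takeS //=; case: eqVneq => [<-|ne].
  rewrite addbT => /negbTE bi0; split=> [run|].
    rewrite leqNgt; apply/negP => lt1m.
    by have := run 1 lt1m isT; rewrite subSS subn0 bi0.
  case: m => [|[|m]] // _ [|k] // _ _.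
  by rewrite subn0 bitS // eqxx bi0.
rewrite addbF => biq; case: m => [|m]; first by split=> // _ k.
have [IH1 IH2] := IHi m (ltnW lt_is) biq; rewrite ltnS; split=> [run|le_m].
  by apply: IH1 => k ltkm leki; have := run k.+1 ltkm leki; rewrite subSS.
move=> [|k] ltkm leki; last by rewrite subSS; apply: IH2.
by rewrite subn0 bitS // (negbTE ne) addbF.
Qed.

Section Words.

Variables (n : nat) (s : seq nat).
Hypothesis s_ok : Beckett_flips n s.

Lemma size_flips : size s = 2 ^ n.
Proof. by case/and5P: s_ok => /eqP. Qed.

Lemma flip_lt (i : 'I_(2 ^ n)) : nth 0 s i < n.
Proof.
case/and5P: s_ok => _ /all_nthP lt_s _ _ _.
by apply: (lt_s 0); rewrite size_flips.
Qed.

Lemma tnth_words (i : 'I_(2 ^ n)) (q : 'I_n) : tnth (words n s i) q = bit s i q.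
Proof. exact: tnth_mktuple. Qed.

Lemma words_inj : injective (words n s).
Proof.
case/and5P: s_ok => _ _ _ uniq_w _ i j eq_ij; apply: val_inj.
move/(uniqP [::]): uniq_w; rewrite size_map size_iota => inj_w.
apply: inj_w; [by rewrite inE ltn_ord | by rewrite inE ltn_ord |].
rewrite !(nth_map 0) ?size_iota ?ltn_ord // !nth_iota ?ltn_ord //.
apply/eq_in_map => q; rewrite mem_iota => /= lt_qn.
by have := congr1 (fun t => tnth t (Ordinal lt_qn)) eq_ij; rewrite !tnth_words.
Qed.

Lemma words_bij : bijective (words n s).
Proof.
apply: inj_card_bij words_inj _.
by rewrite card_tuple card_bool card_ord.
Qed.

Lemma bit_ordS (i : 'I_(2 ^ n)) (q : 'I_n) :
  bit s (ordS i) q = bit s i q (+) (nth 0 s i == q).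
Proof.
rewrite -bitS ?size_flips //=.
have [lt_i|] := ltnP i.+1 (2 ^ n); first by rewrite modn_small.
move=> le_i; have {le_i}-> : i.+1 = 2 ^ n.
  by apply/eqP; rewrite eqn_leq le_i ltn_ord.
(* At the last index [ordS] wraps to time 0, where all bits are 0; parity gives 0 at time [2 ^ n] as
   well. *)
rewrite modnn bit0 /bit -size_flips take_size; apply/esym/negbTE.
have /and5P[_ _ /allP even_s _ _] := s_ok.
by apply: even_s; rewrite mem_iota /=.
Qed.

Lemma run_length_words (i : 'I_(2 ^ n)) (q : 'I_n) :
  bit s i q ->
  run_length (words n s) i q = (index (q : nat) (rev (take i s))).+1.
Proof.
move=> biq; set r := _.+1.
have le_is : i <= size s by rewrite size_flips ltnW.
have r_le_i : r <= i.
  (* An odd count is positive, so [q] occurs among the first [i] flips and a run of length [r] does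
     not reach back to time 0. *)
  rewrite /r -[leqRHS](size_takel le_is) -size_rev index_mem mem_rev.
  by rewrite -has_pred1 has_count; apply: odd_gt0.
have back k : k <= i ->
    tnth (words n s (iter k (@ord_pred (2 ^ n)) i)) q = bit s (i - k) q.
  by move=> le_ki; rewrite tnth_words val_iter_ord_pred.
have [_ /forallP run_r max_r] :=
  run_lengthP words_bij (etrans (tnth_words i q) biq).
apply/eqP; rewrite eqn_leq; apply/andP; split.
  (* Only the part of the cyclic run with [k <= i] is consulted, where [ord_pred] has not yet
     wrapped. *)
  apply: (proj1 (bit_runE _ _ _ _ le_is biq)) => k lt_k le_ki.
  by rewrite -back //; exact: run_r (Ordinal lt_k).
apply: max_r; apply/forallP => -[k lt_kr] /=.
have le_ki : k <= i by apply: ltnW (leq_trans lt_kr r_le_i).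
by rewrite back //; apply: (proj2 (bit_runE _ _ _ r le_is biq)).
Qed.

Lemma Beckett_flipsP : cyclic_Beckett_Gray_code (words n s).
Proof.
split; first split; first exact: words_bij.
  move=> i; apply: etrans (cards1 (Ordinal (flip_lt i))); apply: eq_card => q.
  rewrite !inE !tnth_words bit_ordS -val_eqE /= [RHS]eq_sym.
  by case: (bit s i q); case: (nth 0 s i == q).
(* Only the flipped position changes, so [p] is the flip at time [i]; the [oldest] check there
   compares indices, hence run lengths. *)
move=> i p; rewrite !tnth_words bit_ordS => bip; rewrite bip negbK => /eqP ep q.
move=> ne_qp biq; rewrite tnth_words in biq.
rewrite !run_length_words // ltnS.
case/and5P: s_ok => _ _ _ _ /allP /(_ i); rewrite mem_iota ltn_ord ep bip.
move=> /(_ isT) /allP /(_ q); rewrite mem_iota ltn_ord biq andbT.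
by rewrite (inj_eq val_inj) ne_qp => /(_ isT).
Qed.

End Words.

Definition flips7 : seq nat :=
  [:: 0; 1; 0; 2; 3; 1; 0; 2; 1; 2; 3; 4; 0; 3; 1; 5; 6; 2; 4; 0; 3; 5; 4; 3; 5; 6; 0; 4; 0; 1; 3; 6;
      5; 4; 0; 5; 1; 6; 2; 4; 3; 6; 0; 5; 2; 1; 5; 2; 3; 4; 6; 0; 6; 1; 5; 3; 2; 4; 1; 5; 6; 3; 4; 3;
      0; 2; 6; 1; 5; 1; 4; 3; 4; 0; 3; 2; 0; 6; 2; 1; 5; 4; 1; 3; 0; 6; 2; 5; 2; 1; 3; 1; 5; 6; 4; 6;
      2; 0; 3; 1; 2; 5; 4; 6; 0; 4; 2; 6; 4; 5; 2; 0; 6; 4; 5; 2; 3; 0; 4; 1; 4; 3; 0; 5; 1; 4; 0; 5].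

Definition flips8 : seq nat :=
  [:: 0; 1; 2; 0; 3; 1; 2; 1; 3; 4; 3; 0; 5; 6; 2; 1; 4; 3; 0; 7; 5; 3; 4; 6; 2; 6; 7; 1; 0; 2; 7; 3;
      4; 6; 3; 1; 0; 2; 1; 5; 7; 2; 4; 3; 1; 7; 6; 5; 1; 2; 0; 5; 4; 2; 3; 7; 6; 1; 0; 6; 5; 2; 5; 3;
      7; 1; 6; 5; 2; 5; 7; 1; 7; 2; 5; 2; 7; 4; 6; 1; 2; 4; 5; 6; 1; 3; 4; 5; 0; 6; 3; 7; 3; 1; 4; 5;
      0; 4; 2; 0; 6; 7; 3; 6; 7; 1; 5; 4; 2; 5; 4; 0; 1; 6; 0; 7; 5; 6; 4; 2; 3; 7; 1; 4; 5; 0; 6; 2;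
      0; 2; 3; 7; 4; 1; 7; 4; 5; 3; 0; 5; 2; 0; 6; 1; 7; 4; 3; 5; 3; 1; 5; 0; 4; 6; 3; 6; 2; 1; 3; 5;
      0; 4; 6; 2; 7; 4; 1; 3; 0; 3; 6; 2; 7; 5; 4; 7; 1; 0; 3; 6; 3; 1; 2; 5; 7; 2; 4; 0; 3; 0; 6; 1;
      5; 2; 1; 4; 2; 0; 7; 4; 6; 5; 1; 2; 6; 7; 5; 3; 7; 4; 6; 2; 1; 5; 6; 3; 7; 3; 2; 7; 1; 0; 5; 6;
      3; 7; 4; 0; 7; 0; 5; 4; 2; 4; 3; 7; 0; 5; 0; 2; 4; 1; 3; 7; 5; 6; 0; 1; 7; 2; 0; 6; 4; 2; 0; 4].

Theorem mainTheorem3 :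
  (exists w : 'I_(2 ^ 7) -> 7.-tuple bool, cyclic_Beckett_Gray_code w) /\
  (exists w : 'I_(2 ^ 8) -> 8.-tuple bool, cyclic_Beckett_Gray_code w).
Proof.
split.
  by exists (words 7 flips7); apply: Beckett_flipsP; vm_compute.
by exists (words 8 flips8); apply: Beckett_flipsP; vm_compute.
Qed.
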